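(* Let $\Phi$ be a balanced relative simplicial complex of dimension $d-1$, let a finite group $\mathfrak G$ act on $\Phi$, and suppose that $\Phi$ satisfies $(S_\ell)$. Then $h_i(\Phi,\mathfrak G)\ge_{\mathfrak G}0$ for $i\le\ell$. Moreover, for $0\le i\le\ell\le j\le d$, \[\sum_{k=\ell}^{j}\binom{d-k}{j-k}\binom{k-\ell+i}{i}h_k(\Phi,\mathfrak G)\ \ge_{\mathfrak G}\ 0.\]
   Context: A balanced relative simplicial complex of dimension $d-1$ on finite vertex set $V$ is a nonempty collection $\Phi$ of subsets of $V$ with $\kappa:V\to[d]$ such that: (i) $\rho\subseteq\sigma\subseteq\tau$, $\rho,\tau\in\Phi$ implies $\sigma\in\Phi$; (ii) every face lies in a face of size $d$; (iii) $\kappa$ is injective on faces. $\kappa(\sigma)=\{\kappa(v):v\in\sigma\}$. A finite group $\mathfrak G$ acts on $\Phi$ if it acts on $V$ preserving $\kappa$ and mapping faces to faces. $f_S(\Phi,\mathfrak G)$ is the permutation character of $\mathfrak G$ on $\{\sigma\in\Phi:\kappa(\sigma)=S\}$; $h_S(\Phi,\mathfrak G)=\sum_{T\subseteq S}(-1)^{|S\setminus T|}f_T(\Phi,\mathfrak G)$; the equivariant $h$-vector is $h_i(\Phi,\mathfrak G)=\sum_{S\subseteq[d],|S|=i}h_S(\Phi,\mathfrak G)$. $\chi\ge_{\mathfrak G}0$ means $\chi$ is an effective character (nonnegative integer combination of irreducible characters). Homology of a collection $\Psi$ satisfying (i): reduced chain complex with basis in degree $i$ the faces of cardinality $i+1$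 and simplicial boundary omitting faces not in $\Psi$ (i.e. relative homology $\widetilde H(\Delta,\Gamma)$ for $\Psi=\Delta\setminus\Gamma$); $\dim\Psi=\max\{|\tau|-1:\tau\in\Psi\}$; $\mathrm{lk}_\Psi(\sigma)=\{\tau\subseteq V\setminus\sigma:\tau\cup\sigma\in\Psi\}$. $\Phi$ satisfies $(S_\ell)$ if $\widetilde H_{i-1}(\mathrm{lk}_\Phi(\sigma))=0$ for every $\sigma$ contained in a face of $\Phi$ and every integer $i\le\min(\dim\mathrm{lk}_\Phi(\sigma),\ell-1)$. *)

(* Defs.v *)
From HB Require Import structures.
From mathcomp Require Import all_boot all_order all_algebra all_fingroup.
From mathcomp Require Import all_solvable all_field all_character.

Set Implicit Arguments.
Unset Strict Implicit.
Unset Printing Implicit Defensive.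

Import Order.TTheory GroupScope GRing.Theory Num.Theory.
Local Open Scope ring_scope.

Section RelativeComplexes.
Variable V : finType.
Implicit Types (Psi : {set {set V}}) (s t r : {set V}).

(* Colours in [d] = {1, ..., d} are represented by 'I_d = {0, ..., d - 1}. *)
Definition balanced_relative_complex (d : nat) (Phi : {set {set V}})
    (kappa : V -> 'I_d) : Prop :=
  [/\ Phi != set0,
      forall r s t, r \subset s -> s \subset t ->
        r \in Phi -> t \in Phi -> s \in Phi,
      forall s, s \in Phi -> exists2 t, t \in Phi & s \subset t /\ #|t| = d
    & forall s, s \in Phi -> {in s &, injective kappa}].

Definition dimc Psi : int := (\max_(t in Psi) #|t|)%N%:Z - 1.

Definition link Psi s : {set {set V}} :=
  [set t : {set V} | [disjoint t & s] && (t :|: s \in Psi)].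

Section Homology.
Variable R : idomainType.

(* The chain group in degree q is represented by the functions supported on
   the faces of cardinality q + 1.  It vanishes for q < -1; in degree -1 the
   only possible basis element is the empty face. *)
Definition is_chain Psi (q : int) (c : {ffun {set V} -> R}) : Prop :=
  forall s, c s != 0 -> s \in Psi /\ #|s|%:Z = q + 1.

(* Position of v in s, for the total order on V given by enum_rank. *)
Definition face_pos (v : V) s : nat :=
  #|[set w in s | (enum_rank w < enum_rank v)%N]|.

(* Linear extension of
     s |-> \sum_(v in s | s :\ v \in Psi) (-1) ^+ face_pos v s * (s :\ v). *)
Definition boundary Psi (c : {ffun {set V} -> R}) : {ffun {set V} -> R} :=
  [ffun t => \sum_(s : {set V})
     \sum_(v in s | (s :\ v \in Psi) && (s :\ v == t))
        (-1) ^+ face_pos v s * c s].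

(* Cycles modulo boundaries in degree q is the zero module. *)
Definition homology_vanishes Psi (q : int) : Prop :=
  forall c, is_chain Psi q c -> boundary Psi c = 0 ->
    exists2 b, is_chain Psi (q + 1) b & boundary Psi b = c.

Definition serre_condition (l : nat) (Phi : {set {set V}}) : Prop :=
  forall s, (exists2 t, t \in Phi & s \subset t) ->
  forall i : int, i <= Num.min (dimc (link Phi s)) (l%:Z - 1) ->
    homology_vanishes (link Phi s) (i - 1).

End Homology.
End RelativeComplexes.

Section PermutationCharacter.
Variables (gT : finGroupType) (G : {group gT}) (T : finType) (to : action G T).
Variables (A : {set T}) (nA : [acts G, on A | to]).

Definition act_perm_mx (g : gT) : 'M[algC]_#|A| :=
  \matrix_(i, j) (to (enum_val i) g == enum_val j)%:R.

Lemma act_perm_mx_repr : mx_repr G act_perm_mx.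
Proof.
split=> [|x y Gx Gy]; apply/matrixP=> i j; rewrite !mxE.
  by rewrite act1 (inj_eq enum_val_inj).
have Ax : to (enum_val i) x \in A by rewrite (acts_act nA) // enum_valP.
rewrite (bigD1 (enum_rank_in Ax (to (enum_val i) x))) //= big1 => [|k nk].
  by rewrite !mxE enum_rankK_in // eqxx mul1r addr0 actMin.
rewrite !mxE; case: eqP => [e|_]; last by rewrite mul0r.
by case/eqP: nk; apply: enum_val_inj; rewrite enum_rankK_in.
Qed.

Definition perm_char : 'CF(G) := cfRepr (MxRepresentation act_perm_mx_repr).

Lemma perm_charE g : g \in G -> perm_char g = #|'Fix_(A | to)[g]|%:R.
Proof.
move=> Gg; rewrite cfunE Gg mulr1n /mxtrace.
under eq_bigr do rewrite mxE.
rewrite -(big_enum_val (fun x => (to x g == x)%:R : algC)) /=.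
rewrite -[in RHS]sum1_card natr_sum.
rewrite [RHS](eq_bigl (fun x => (x \in A) && (to x g == x))); last first.
  by move=> x; rewrite !inE sub1set inE.
by rewrite big_mkcondr /=; apply: eq_bigr => x _; case: eqP.
Qed.

End PermutationCharacter.

Section EquivariantHVector.
Variables (V : finType) (d : nat) (Phi : {set {set V}}) (kappa : V -> 'I_d).
Variables (gT : finGroupType) (G : {group gT}) (to : action G V).

(* to^* is the induced action on subsets of V. *)
Definition acts_on_complex : Prop :=
  (forall g v, g \in G -> kappa (to v g) = kappa v) /\ [acts G, on Phi | to^*].

Definition colored_faces (S : {set 'I_d}) : {set {set V}} :=
  [set s in Phi | kappa @: s == S].

Lemma acts_colored_faces (S : {set 'I_d}) :
  acts_on_complex -> [acts G, on colored_faces S | to^*].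
Proof.
case=> kG nPhi; apply/subsetP=> g Gg; rewrite !inE Gg /=.
apply/subsetP=> s; rewrite !inE => /andP[Ps /eqP <-].
rewrite (acts_act nPhi) // Ps /=; apply/eqP; rewrite /= /setact -imset_comp.
by apply: eq_imset => v /=; rewrite kG.
Qed.

Variable actG : acts_on_complex.

Definition f_color (S : {set 'I_d}) : 'CF(G) :=
  perm_char (acts_colored_faces S actG).

Definition h_color (S : {set 'I_d}) : 'CF(G) :=
  \sum_(T : {set 'I_d} | T \subset S) (-1) ^+ #|S :\: T| *: f_color T.

Definition h_vector (i : nat) : 'CF(G) :=
  \sum_(S : {set 'I_d} | #|S| == i) h_color S.

End EquivariantHVector.

(* Main.v *)
Require Import Defs.
From HB Require Import structures.
From mathcomp Require Import all_boot all_order all_algebra all_fingroup.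
From mathcomp Require Import all_solvable all_field all_character.

Set Implicit Arguments.
Unset Strict Implicit.
Unset Printing Implicit Defensive.

Import Order.TTheory GroupScope GRing.Theory Num.Theory.
Local Open Scope ring_scope.

(** For disjoint sets of colours A and B, the faces whose colour set lies between
    A and A :|: B form a chain complex under removal of vertices with colour in
    B.  Signs are taken from the order of the colours, so that G commutes with
    the boundary.  For B the complement of A this complex is the direct sum,
    over s of colour set A, of the chain complexes of the links of s; removing
    one colour at a time from B, the long exact sequence of a pair propagates
    exactness below the top degree whenever #|B| <= l.  Exactness over a domain
    of any characteristic passes to algC by comparing ranks of integer matrices,
    and then the alternating sum of the permutation characters, which equals the
    sum of the h_S over B \subset S \subset A :|: B, is the character of the
    kernel in top degree.

    Both claims are sums of such interval sums.  For the second, 'C(d - k, j - k)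
    counts the sets T of size j containing S, and 'C(k - l + i, i) counts the
    l-subsets B of S containing the l - i smallest elements of S; for fixed T and
    B, the sets S so counted form an interval with bottom B. *)

(** * Ranks of integer matrices over different fields *)

Section IntegerMatrices.

(** The product of the denominators of the entries clears all of them at once. *)
Lemma row_common_denominator (R : idomainType) n (u : 'rV[{fraction R}]_n) :
  exists2 a : R, a != 0 &
    exists v : 'rV[R]_n, tofrac a *: u = map_mx (@tofrac R) v.
Proof.
have denom j : exists2 a : R, a != 0 &
    exists b : R, tofrac a * u 0 j = tofrac b.
  elim/quotW: (u 0 j) => x; exists x.2; first exact: denom_ratioP.
  exists x.1; have x2 := denom_ratioP x.
  unlock FracField.tofrac; rewrite -[LHS]FracField.pi_mul; apply/eqmodP.
  rewrite /= FracField.equivfE /FracField.mulf !numden_Ratio ?oner_eq0 //.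
  - by rewrite mul1r mulr1.
  - by rewrite mul1r.
  - by rewrite mul1r.
have [d d0 /fin_all_exists[b bP]] := fin_all_exists2 denom.
exists (\prod_j d j); first by apply/prodf_neq0 => j _.
exists (\row_j (b j * \prod_(i | i != j) d i)).
apply/rowP=> j; rewrite !mxE (bigD1 j) //= !tofracM mulrAC bP //.
Qed.

(** A nonsingular square submatrix over [K] of the maximal order has an integer determinant that is
    nonzero in [K], hence nonzero as an integer, hence nonzero in [L]. *)
Lemma mxrank_intr_le (K : fieldType) (L : numFieldType) m n
    (M : 'M[int]_(m, n)) :
  (\rank (map_mx intr M : 'M[K]_(m, n)) <=
     \rank (map_mx intr M : 'M[L]_(m, n)))%N.
Proof.
set A : 'M[K]_(m, n) := map_mx intr M.
have fullT : row_full (rowsub (maxrankfun A) A)^T.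
  by rewrite /row_full mxrank_tr; apply: maxrowsub_free.
set f := maxrankfun A in fullT; pose g := fullrankfun fullT.
have unitA : mxsub f g A \in unitmx.
  rewrite -unitmx_tr; apply: etrans (fullrowsub_unit fullT).
  by congr (_ \in unitmx); apply/matrixP=> i j; rewrite !mxE.
have det0 : \det (mxsub f g M) != 0.
  move: unitA; rewrite unitmxE unitfE -map_mxsub det_map_mx.
  by apply: contraNneq => ->; rewrite rmorph0.
have /mxrank_unit rk : map_mx (intr : int -> L) (mxsub f g M) \in unitmx.
  by rewrite unitmxE unitfE det_map_mx intr_eq0.
rewrite -[X in (X <= _)%N]rk map_mxsub mxsubrc.
set B := map_mx _ M; have subT : ((rowsub f (colsub g B)) <= colsub g B)%MS.
  by apply/row_subP => i; rewrite row_rowsub row_sub.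
apply: leq_trans (mxrankS subT) _.
rewrite -mxrank_tr -[X in (_ <= X)%N]mxrank_tr trmx_mxsub; apply: mxrankS.
by apply/row_subP => i; rewrite row_rowsub row_sub.
Qed.

(* Exactness means rank M + rank N = q, while M *m N = 0 forces
   rank M + rank N <= q over every field: since the rank of an integer matrix
   is largest in characteristic zero, exactness persists there. *)
Lemma exact_intr_char0 (R : idomainType) (L : numFieldType) p q r
    (M : 'M[int]_(p, q)) (N : 'M[int]_(q, r)) :
  M *m N = 0 ->
  (forall u : 'rV[R]_q, u *m map_mx intr N = 0 ->
     exists w : 'rV[R]_p, w *m map_mx intr M = u) ->
  (kermx (map_mx intr N : 'M[L]_(q, r)) :=: (map_mx intr M : 'M[L]_(p, q)))%MS.
Proof.
move=> MN0 exR; pose K := {fraction R}.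
(* Exactness over [R] extends to its fraction field by clearing denominators. *)
have kerK : (kermx (map_mx intr N : 'M[K]_(q, r)) <= map_mx intr M)%MS.
  apply/rV_subP=> u /sub_kermxP uN0.
  have [a a0 [v vE]] := row_common_denominator u.
  have intrF : (intr : int -> K) =1 @tofrac R \o intr.
    by move=> z /=; rewrite rmorph_int.
  have [|w wE] := exR v.
    have: map_mx (@tofrac R) (v *m map_mx intr N) = 0.
      rewrite map_mxM -vE -map_mx_comp -(eq_map_mx _ intrF).
      by rewrite -scalemxAl uN0 scaler0.
    move=> /matrixP vN0; apply/matrixP=> i j; have := vN0 i j.
    by rewrite !mxE => /eqP; rewrite tofrac_eq0 => /eqP.
  have aK : tofrac a != 0 by rewrite tofrac_eq0.
  have -> : u = (tofrac a)^-1 *: (tofrac a *: u).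
    by rewrite scalerA mulVf // scale1r.
  rewrite vE -wE map_mxM -map_mx_comp -(eq_map_mx _ intrF).
  by apply: scalemx_sub; apply: submxMl.
set NL := map_mx _ N; set ML := map_mx _ M.
have MNL : (ML <= kermx NL)%MS by apply/sub_kermxP; rewrite -map_mxM MN0 raddf0.
(* Given one inclusion, it suffices to compare ranks: [q] minus the rank of [N] over [L] is at most
   the same difference over [K], which is at most the rank of [M] over [K], hence over [L]. *)
apply/eqmx_sym/eqmxP; rewrite -(geq_leqif (mxrank_leqif_eq MNL)) mxrank_ker.
apply: leq_trans (mxrank_intr_le K L M); apply: leq_trans (mxrankS kerK).
by rewrite mxrank_ker leq_sub2l ?mxrank_intr_le.
Qed.

End IntegerMatrices.

(** * Characters of exact complexes of representations *)

Section ExactRepresentations.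
Variables (gT : finGroupType) (G : {group gT}).

(** Equivariant rank-nullity: [M] induces an isomorphism from the quotient by its kernel onto its
    image, and the trace is additive over a submodule and its quotient. *)
Lemma cfRepr_ker_im n m (rG1 : mx_representation algC G n)
    (rG2 : mx_representation algC G m) (M : 'M_(n, m)) U W
    (modU : mxmodule rG1 U) (modW : mxmodule rG2 W) :
  (forall x, x \in G -> rG1 x *m M = M *m rG2 x) ->
  (U :=: kermx M)%MS -> (W :=: M)%MS ->
  cfRepr rG1 = cfRepr (submod_repr modU) + cfRepr (submod_repr modW).
Proof.
move=> homM eqU eqW; apply/cfun_inP=> x Gx; rewrite !cfunE Gx !mulr1n.
rewrite -(mxtrace_sub_fact_mod modU); congr (_ + _).
have UM0 p (A : 'M_(p, n)) : (A <= U)%MS -> A *m M = 0.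
  by rewrite eqU => /sub_kermxP.
have MW p (A : 'M_(p, n)) : (A *m M <= W)%MS by rewrite eqW submxMl.
have in_submodM p q (A : 'M_(p, q)) X : A *m in_submod W X = in_submod W (A *m X).
  by rewrite in_submodE [RHS]in_submodE mulmxA.
apply: mxtrace_rsim Gx.
exists (in_submod W (val_factmod (U := U) 1%:M *m M)) => [||y Gy].
- by rewrite mxrank_coker eqU eqW mxrank_ker subKn ?rank_leq_row.
- apply/inj_row_free=> w.
  rewrite in_submodM mulmxA -val_factmodE => /(congr1 val_submod).
  rewrite in_submodK // linear0 => vM0.
  have: (val_factmod w <= U)%MS by rewrite eqU; apply/sub_kermxP.
  by rewrite -in_factmod_eq0 val_factmodK => /eqP.
rewrite -in_submodJ // in_submodM mulmxA -val_factmodE.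
apply: (congr1 (in_submod W)); rewrite -[RHS]mulmxA -homM // mulmxA.
(* The lift from the quotient commutes with [y] only modulo [U], but [M] vanishes on [U]. *)
rewrite -[in RHS](add_sub_fact_mod U (val_factmod 1%:M *m rG1 y)) mulmxDl.
by rewrite [X in X + _]UM0 ?val_submodP // add0r.
Qed.

(** By induction on [k], the sum truncated at degree [k] is the character of the module [Z k] of
    cycles; below the top, exactness identifies [Z k] with the image of [D k]. *)
Lemma alternating_exact_char (b : nat) (n : nat -> nat)
    (rG : forall k, mx_representation algC G (n k))
    (D : forall k, 'M[algC]_(n k.+1, n k)) :
  (forall k x, x \in G -> rG k.+1 x *m D k = D k *m rG k x) ->
  ((0 < b)%N -> row_full (D 0)) ->
  (forall k, (k.+1 < b)%N -> (kermx (D k) :=: D k.+1)%MS) ->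
  \sum_(m < b.+1) (-1) ^+ (b - m) *: cfRepr (rG m) \is a character.
Proof.
move=> homD full0 exD.
pose Z k : 'M_(n k) := if k is k'.+1 then kermx (D k') else 1%:M.
suffices H k : (k <= b)%N -> exists modZ : mxmodule (rG k) (Z k),
    \sum_(m < k.+1) (-1) ^+ (k - m) *: cfRepr (rG m) = cfRepr (submod_repr modZ).
  by have [modZ ->] := H b (leqnn b); apply: cfRepr_char.
elim: k => [_|k IHk ltkb].
  have modZ := mxmodule1 (rG 0%N); exists modZ.
  rewrite big_ord1 scale1r; apply/cfRepr_sim/mx_rsim_sym.
  exact: rsim_submod1 (eqmx_refl _).
have [modZ eqZ] := IHk (ltnW ltkb).
have modK : mxmodule (rG k.+1) (Z k.+1).
  apply/mxmoduleP=> x Gx; apply/sub_kermxP.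
  by rewrite -mulmxA homD // mulmxA mulmx_ker mul0mx.
have ZD : (Z k :=: D k)%MS.
  case: (k) ltkb => [|k'] /= ltkb; last exact: exD.
  by apply/eqmxP; rewrite submx1 sub1mx full0.
(* Adding the character of [Z k] cancels every term of degree at most [k], and what remains is
   rank-nullity for [D k]. *)
exists modK; apply: (addIr (cfRepr (submod_repr modZ))).
rewrite -(cfRepr_ker_im modK modZ (homD k) (eqmx_refl _) ZD) -eqZ big_ord_recr /=.
rewrite subnn scale1r addrAC -big_split /= big1 ?add0r // => i _.
have leik : (i <= k)%N by rewrite -ltnS.
by rewrite subSn // exprS mulN1r scaleNr addNr.
Qed.

End ExactRepresentations.

(** * Chain complexes attached to intervals of colour sets *)

Lemma disjointsU1 (T : finType) (a : T) (A B : {set T}) :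
  [disjoint a |: A & B] = (a \notin B) && [disjoint A & B].
Proof. by rewrite !disjoints_subset subUset sub1set in_setC. Qed.

Section ColourComplexes.
Variables (V : finType) (d : nat) (Phi : {set {set V}}) (kappa : V -> 'I_d).
Hypothesis balPhi : balanced_relative_complex Phi kappa.
Implicit Types (A B : {set 'I_d}) (s t : {set V}) (n : nat).

Definition colour_pos (v : V) t : nat := (\sum_(w in t) (kappa w < kappa v))%N.

(** Degrees are cardinalities here, one more than dimensions. *)
Definition faces A B n : {set {set V}} :=
  [set t in Phi |
     [&& A \subset kappa @: t, kappa @: t \subset A :|: B & #|t| == n]].

Lemma faces_Phi A B n t : t \in faces A B n -> t \in Phi.
Proof. by rewrite inE => /andP[]. Qed.

Lemma faces_subset A B A' B' n t :
    A' \subset kappa @: t -> kappa @: t \subset A' :|: B' ->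
  t \in faces A B n -> t \in faces A' B' n.
Proof. by move=> At tB; rewrite !inE At tB => /and4P[-> _ _ ->]. Qed.

Lemma kappa_U1 v t : v \notin t -> v |: t \in Phi -> kappa v \notin kappa @: t.
Proof.
case: balPhi => _ _ _ injk vt /injk kinj; apply/imsetP=> -[w wt kvw].
by move: vt; rewrite (kinj v w) ?inE ?eqxx ?wt ?orbT.
Qed.

Lemma faces_U1 A B n v t : [disjoint A & B] -> v \notin t -> kappa v \in B ->
  t \in Phi -> v |: t \in faces A B n.+1 -> t \in faces A B n.
Proof.
move=> dAB vt vB tPhi; rewrite !inE tPhi imsetU1 cardsU1 vt add1n eqSS.
case/and4P=> _ At tAB ->; rewrite andbT /=; apply/andP; split.
  apply/subsetP=> a aA; have := subsetP At a aA; rewrite in_setU1.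
  by case/predU1P=> // eav; rewrite -eav (disjointFr dAB aA) in vB.
by apply: subset_trans tAB; apply: subsetUr.
Qed.

Section Chains.
Variable K : comNzRingType.
Implicit Types c z y : {set V} -> K.

(** Written as the coefficient at [t], collected from the faces with one more vertex; the value 0
    outside [Phi] makes it the relative boundary. *)
Definition colour_boundary B c t : K :=
  if t \in Phi then
    \sum_(v | (v \notin t) && (kappa v \in B))
       (-1) ^+ colour_pos v t * c (v |: t)
  else 0.

Definition supported A B n c := forall t, t \notin faces A B n -> c t = 0.

Definition exact_at A B n := forall z, supported A B n z ->
  (forall t, colour_boundary B z t = 0) ->
  exists2 y, supported A B n.+1 y & forall t, colour_boundary B y t = z t.

Lemma supported_boundary A B n c : [disjoint A & B] ->
  supported A B n.+1 c -> supported A B n (colour_boundary B c).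
Proof.
move=> dAB cS t tF; rewrite /colour_boundary; case: ifP => // tPhi.
apply: big1 => v /andP[vt vB]; rewrite cS ?mulr0 //; apply: contra tF.
exact: faces_U1.
Qed.

Lemma supported_Phi A B n c t : supported A B n c -> t \notin Phi -> c t = 0.
Proof. by move=> cS tPhi; apply: cS; apply: contra tPhi => /faces_Phi. Qed.

Lemma colour_posU1 v w t : w \notin t ->
  colour_pos v (w |: t) = ((kappa w < kappa v) + colour_pos v t)%N.
Proof. by move=> wt; rewrite /colour_pos big_setU1. Qed.

(** The terms that add [v] then [w] and [w] then [v] cancel: the vertex of smaller colour shifts the
    position of the other one, and not conversely. *)
Lemma colour_boundaryK B c : (forall t, t \notin Phi -> c t = 0) ->
  forall t, colour_boundary B (colour_boundary B c) t = 0.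
Proof.
move=> cPhi t; rewrite {1}/colour_boundary; case: ifP => // tPhi.
pose P v := (v \notin t) && (kappa v \in B).
pose F v w := (-1) ^+ colour_pos v t *
  ((-1) ^+ colour_pos w (v |: t) * c (w |: (v |: t))) : K.
have FE v : P v -> (-1) ^+ colour_pos v t * colour_boundary B c (v |: t) =
    \sum_(w | P w && (w != v)) F v w.
  move=> /andP[vt vB]; rewrite [RHS](eq_bigl
      (fun w => (w \notin v |: t) && (kappa w \in B))); last first.
    by move=> w; rewrite !inE negb_or /P -!andbA andbC -!andbA; do !bool_congr.
  rewrite /colour_boundary; case: ifPn => [_|vtPhi]; first by rewrite mulr_sumr.
  (* Convexity of [Phi]: a set above [t] that is omitted by the relative boundary is contained in no
     face. *)
  rewrite mulr0 big1 // => w _; rewrite /F cPhi ?mulr0 //.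
  apply: contra vtPhi => wvt; case: balPhi => _ cvx _ _.
  by apply: cvx tPhi wvt; apply: subsetUr.
rewrite (eq_bigr _ FE).
have split_lt v : P v -> \sum_(w | P w && (w != v)) F v w =
    \sum_(w | P w && (kappa v < kappa w)%N) F v w
    + \sum_(w | P w && (kappa w < kappa v)%N) F v w.
  move=> Pv; rewrite (bigID (fun w => kappa v < kappa w)%N) /=.
  congr (_ + _).
    by apply: eq_bigl => w; case: eqVneq => [->|]; rewrite ?ltnn ?andbF ?andbT.
  rewrite (bigID (fun w => kappa w < kappa v)%N) /= [X in _ + X]big1 ?addr0.
    apply: eq_bigl => w; case: ltngtP; rewrite ?andbF ?andbT //.
    by case: eqVneq => [->|]; rewrite ?ltnn ?andbT.
  move=> w /andP[/andP[/andP[/andP[wt wB] nwv] le1] le2].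
  (* Two distinct vertices of one colour lie in no common face, so these terms vanish. *)
  have eqk : kappa w = kappa v.
    by apply/val_inj/eqP; rewrite eqn_leq leqNgt le1 leqNgt le2.
  rewrite /F cPhi ?mulr0 //; apply/negP=> /kappa_U1.
  rewrite !inE negb_or nwv wt => /(_ isT); rewrite imsetU1 eqk.
  by rewrite setU11.
rewrite (eq_bigr _ split_lt) big_split /= [X in _ + X](exchange_big_dep P) /=.
  rewrite -big_split big1 // => v Pv /=.
  rewrite [X in _ + X](eq_bigl (fun w => P w && (kappa v < kappa w)%N)); last first.
    by move=> w; rewrite Pv.
  rewrite -big_split big1 // => w /andP[Pw ltvw] /=.
  have [vt _] := andP Pv; have [wt _] := andP Pw.
  rewrite /F !colour_posU1 // ltvw (ltnNge (kappa w)) (ltnW ltvw) /= add0n.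
  rewrite !mulrA -!exprD setUCA -mulrDl addnCA exprS mulN1r addnC.
  by rewrite addrC addnC subrr mul0r.
by move=> v w _ /andP[].
Qed.

Lemma colour_boundary_setD1 a B c t : (forall s, a \in kappa @: s -> c s = 0) ->
  colour_boundary B c t = colour_boundary (B :\ a) c t.
Proof.
move=> c0; rewrite /colour_boundary; case: ifP => // _.
rewrite (bigID (fun v => kappa v == a)) /= big1 ?add0r; last first.
  by move=> v /andP[_ /eqP va]; rewrite c0 ?mulr0 // -va imset_f ?setU11.
by apply: eq_bigl => v; rewrite !inE -andbA; do !bool_congr.
Qed.

(** A face has at most one vertex of colour [a], so no second one can be added to [t] inside
    [Phi]. *)
Lemma colour_boundary_coloured a B c t : (forall s, s \notin Phi -> c s = 0) ->
  a \in kappa @: t -> colour_boundary B c t = colour_boundary (B :\ a) c t.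
Proof.
move=> cPhi ta; rewrite /colour_boundary; case: ifP => // _.
rewrite (bigID (fun v => kappa v == a)) /= big1 ?add0r; last first.
  move=> v /andP[/andP[vt _] /eqP va]; rewrite cPhi ?mulr0 //.
  by apply: contraL ta; rewrite -va; apply: kappa_U1.
by apply: eq_bigl => v; rewrite !inE -andbA; do !bool_congr.
Qed.

Lemma colour_boundaryB B c z t :
  colour_boundary B (fun s => c s - z s) t =
  colour_boundary B c t - colour_boundary B z t.
Proof.
rewrite /colour_boundary; case: ifP => [_|_]; last by rewrite subr0.
by rewrite -sumrB; apply: eq_bigr => v _; rewrite mulrBr.
Qed.

(* Long exact sequence of the pair formed by the complex of (A, B) and its
   subcomplex without colour a, whose quotient is the complex of
   (a |: A, B :\ a). *)
Lemma exact_at_setD1 a A B n : [disjoint A & B] -> a \in B ->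
  exact_at A B n -> exact_at (a |: A) (B :\ a) n.+1 -> exact_at A (B :\ a) n.
Proof.
move=> dAB aB exAB exaA z zS bz0.
have aA : a \notin A by rewrite (disjointFl dAB).
have AaB : (a |: A) :|: (B :\ a) = A :|: B.
  apply/setP=> x; rewrite !inE.
  by case: eqVneq => [->|]; rewrite /= ?aB ?orbT ?andbT.
have notin_a s m : s \in faces A (B :\ a) m -> a \notin kappa @: s.
  rewrite inE => /and4P[_ _ /subsetP sAB _]; apply/negP=> /sAB.
  by rewrite !inE (negPf aA) eqxx.
have facesW s m : s \in faces A (B :\ a) m -> s \in faces A B m.
  move=> sF; have := sF; rewrite inE => /and4P[_ As sAB _].
  apply: faces_subset sF => //; apply: subset_trans sAB _.
  by rewrite setUS ?subD1set.
have facesWl s m : s \in faces (a |: A) (B :\ a) m -> s \in faces A B m.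
  move=> sF; have := sF; rewrite inE AaB => /and4P[_ As sAB _].
  by apply: faces_subset sF => //; apply: subset_trans As; apply: subsetUr.
have zS' : supported A B n z by move=> t tF; rewrite zS ?(contra (@facesW _ _)).
have z_a s : a \in kappa @: s -> z s = 0.
  by move=> sa; apply/zS; apply: contraL sa; apply: notin_a.
have [|y yS by_z] := exAB z zS'.
  by move=> t; rewrite (colour_boundary_setD1 _ _ z_a).
(* As [z] avoids colour [a], the part of [y] with colour [a] is a cycle of the quotient complex; [w]
   fills it there. *)
pose ya s := if a \in kappa @: s then y s else 0.
have [||w wS bw] := exaA ya.
- move=> s sF; rewrite /ya; case: ifP => // sa; apply/yS; apply: contra sF => sF.
  have := sF; rewrite inE => /and4P[_ As sAB _].
  by apply: faces_subset sF; rewrite ?AaB // subUset sub1set sa.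
- move=> t; case ta: (a \in kappa @: t); last first.
    rewrite /colour_boundary; case: ifP => // _; apply: big1 => v.
    rewrite !inE => /and3P[_ nva _]; rewrite /ya imsetU1 in_setU1 ta.
    by rewrite eq_sym (negPf nva) mulr0.
  have -> : colour_boundary (B :\ a) ya t = colour_boundary (B :\ a) y t.
    rewrite /colour_boundary; case: ifP => // _; apply: eq_bigr => v _.
    by rewrite /ya imsetU1 in_setU1 ta orbT.
  rewrite -colour_boundary_coloured ?by_z ?z_a // => s.
  exact: supported_Phi yS.
have wS' : supported A B n.+2 w.
  by move=> t tF; rewrite wS ?(contra (@facesWl _ _)).
(* Subtracting the boundary of [w] removes colour [a] from [y] without changing its boundary [z]. *)
pose x s := y s - colour_boundary B w s.
have x_a s : a \in kappa @: s -> x s = 0.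
  move=> sa; rewrite /x (colour_boundary_coloured _ _ sa).
    by rewrite bw /ya sa subrr.
  by move=> t; apply: supported_Phi wS.
exists x => t.
  move=> tF; case ta: (a \in kappa @: t); first exact: x_a.
  have tF' : t \notin faces A B n.+1.
    apply: contra tF => tF; have := tF; rewrite inE => /and4P[_ At tAB _].
    apply: faces_subset tF => //; apply/subsetP=> b bt.
    have := subsetP tAB b bt; rewrite !inE.
    by case: eqVneq => // eba; rewrite -eba bt in ta.
  by rewrite /x yS // (supported_boundary dAB wS') // subr0.
rewrite -colour_boundary_setD1 // colour_boundaryB by_z colour_boundaryK ?subr0 //.
by move=> s; apply: supported_Phi wS'.
Qed.

(** Induction on the number of colours outside [A] and [B]: such a colour is added once to [B] and
    once to [A], and [exact_at_setD1] combines the two cases. Both inherit the degree bound. *)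
Lemma exact_at_disjoint l :
    (forall A n, (n < #|A| + minn #|~: A| l)%N -> exact_at A (~: A) n) ->
  forall A B n, [disjoint A & B] -> (n < #|A| + minn #|B| l)%N -> exact_at A B n.
Proof.
move=> exC A B; move: {2}#|_| (leqnn #|~: (A :|: B)|) => k.
elim: k A B => [|k IHk] A B leC n dAB ltn.
  suff BC : B = ~: A by rewrite BC; apply: exC; rewrite -BC.
  apply/eqP; rewrite eqEsubset -disjoints_subset disjoint_sym dAB /=.
  move: leC; rewrite leqn0 cards_eq0 => /eqP/setP ABC.
  by apply/subsetP=> a; have := ABC a; rewrite !inE; case: (a \in A); case: (a \in B).
have [C0|[a]] := set_0Vmem (~: (A :|: B)).
  by apply: IHk => //; rewrite C0 cards0.
rewrite !inE negb_or => /andP[aA aB].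
have cardC : (#|~: (A :|: (a |: B))| <= k)%N.
  rewrite -ltnS; apply: leq_trans leC; apply: proper_card.
  apply/properP; split; first by rewrite setCS setUS ?subsetUr.
  by exists a; rewrite !inE ?negb_or ?aA ?aB ?eqxx ?orbT.
rewrite -(setU1K aB); apply: exact_at_setD1; rewrite ?setU11 //.
- by rewrite disjoint_sym disjointsU1 aA disjoint_sym.
- apply: IHk => //; first by rewrite disjoint_sym disjointsU1 aA disjoint_sym.
  by apply: leq_trans ltn _; rewrite leq_add2l cardsU1 aB leq_min geq_minr
     (leq_trans (geq_minl _ _)) ?leq_addl.
- rewrite setU1K //; apply: IHk.
  + by rewrite -setUA setUCA.
  + by rewrite disjointsU1 aB.
  + by rewrite cardsU1 aA -addnA ltnS.
Qed.

End Chains.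

(** * From vanishing homology of links to exactness *)

Section SerreCondition.
Variable R : idomainType.
Implicit Types c z y : {set V} -> R.

Lemma face_posU1 v t : v \notin t ->
  face_pos v (v |: t) = (\sum_(w in t) (enum_rank w < enum_rank v))%N.
Proof.
move=> vt; rewrite /face_pos -sum1_card big_mkcond [RHS]big_mkcond /=.
apply: eq_bigr => w _; rewrite !inE; case: eqVneq => [->|_] /=.
  by rewrite ltnn (negPf vt).
by case: (w \in t); case: (_ < _)%N.
Qed.

Lemma boundaryE (Psi : {set {set V}}) (c : {ffun {set V} -> R}) t : t \in Psi ->
  boundary Psi c t =
  \sum_(v | v \notin t) (-1) ^+ face_pos v (v |: t) * c (v |: t).
Proof.
move=> tPsi; rewrite ffunE.
rewrite (exchange_big_dep xpredT) //= [RHS]big_mkcond /=.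
apply: eq_bigr => v _; case: ifPn => vt.
  rewrite (big_pred1 (v |: t)) // => s /=; apply/and3P/eqP => [[vs _ /eqP <-]|->].
    by rewrite setD1K.
  by rewrite setU11 setU1K ?tPsi ?eqxx.
rewrite big1 // => s /and3P[vs _ /eqP st].
by move: vt; rewrite -st !inE eqxx.
Qed.

Lemma boundary_out (Psi : {set {set V}}) (c : {ffun {set V} -> R}) t :
  t \notin Psi -> boundary Psi c t = 0.
Proof.
move=> tPsi; rewrite ffunE big1 // => s _; rewrite big1 // => v /and3P[_ svP /eqP st].
by rewrite -st svP in tPsi.
Qed.

(* Passing from the vertex order given by enum_rank inside the link of s to the
   colour order inside t :|: s multiplies the basis element t by the sign of
   this number of inversions. *)
Definition inversions s t : nat :=
  (\sum_(x in t) (colour_pos x s +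
     \sum_(w in t) ((enum_rank w < enum_rank x) && (kappa x < kappa w))))%N.

(** Comparing [v] with each vertex of [t] in the two orders gives counts that differ by twice
    [cross], the number of vertices before [v] in rank and after it in colour. *)
Lemma inversionsU1 s t v : v \notin t -> v \notin s -> [disjoint t & s] ->
    v |: (t :|: s) \in Phi ->
  (-1) ^+ inversions s (v |: t) * (-1) ^+ face_pos v (v |: t) =
  (-1) ^+ inversions s t * (-1) ^+ colour_pos v (t :|: s) :> R.
Proof.
move=> vt vs dts vPhi; have [_ _ _ kinj] := balPhi.
have tinj x : x \in t -> kappa x != kappa v.
  move=> xt; apply: contraNneq vt => /(kinj _ vPhi) <- //.
    by rewrite !inE xt orbT.
  by rewrite setU11.
have rinj x : x \in t -> enum_rank x != enum_rank v.
  by move=> xt; apply: contraNneq vt => /enum_rank_inj <-.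
pose cross := (\sum_(w in t) ((enum_rank w < enum_rank v) && (kappa v < kappa w)))%N.
suff E : (inversions s (v |: t) + face_pos v (v |: t) =
          inversions s t + colour_pos v (t :|: s) + cross.*2)%N.
  by rewrite -!exprD E exprD -mul2n mulnC exprM sqrr_sign mulr1.
have -> : colour_pos v (t :|: s) = (colour_pos v t + colour_pos v s)%N.
  by rewrite /colour_pos -bigU //; apply: eq_bigl => w; rewrite !inE.
have invE : inversions s (v |: t) = (inversions s t + colour_pos v s + cross +
   \sum_(x in t) ((enum_rank v < enum_rank x) && (kappa x < kappa v)))%N.
  rewrite {1}/inversions big_setU1 // (big_setU1 _ vt) /= !ltnn add0n.
  rewrite [X in (_ + X = _)%N](eq_bigr (fun x => (colour_pos x s + \sum_(w in t)
     ((enum_rank w < enum_rank x) && (kappa x < kappa w))) +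
     ((enum_rank v < enum_rank x) && (kappa x < kappa v)))%N); last first.
    by move=> x _; rewrite big_setU1 //= -addnA; congr addn; rewrite addnC.
  rewrite big_split /= -/(inversions s t) -/cross addnA; congr addn.
  by rewrite addnC addnA.
have posE : (face_pos v (v |: t) +
   \sum_(x in t) ((enum_rank v < enum_rank x) && (kappa x < kappa v)) =
   colour_pos v t + cross)%N.
  rewrite face_posU1 // /colour_pos /cross -!big_split /=; apply: eq_bigr => x xt.
  have /eqP := tinj x xt; have /eqP := rinj x xt.
  case: (ltngtP (enum_rank x) (enum_rank v)) => [_ _|_ _|/val_inj-> //];
    by case: (ltngtP (kappa x) (kappa v)) => [||/val_inj->].
rewrite invE -addnn -addnA [X in (_ + X)%N]addnC posE.
by rewrite addnACA -[X in (X + _)%N]addnA [(colour_pos v s + _)%N]addnC.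
Qed.

(** The part of a chain on the faces containing [s], carried to the link of [s]; disjointness makes
    each such face count once. *)
Definition twist s c : {ffun {set V} -> R} :=
  [ffun t : {set V} => if [disjoint t & s] then
     (-1) ^+ inversions s t * c (t :|: s) else 0].

(** The vertices of [s] use up the colours of [A], so those that extend [t :|: s] inside [Phi] all
    have colours outside [A]; the signs match by [inversionsU1]. *)
Lemma boundary_twist A s t c : (forall r, r \notin Phi -> c r = 0) ->
    kappa @: s = A -> t \in link Phi s ->
  boundary (link Phi s) (twist s c) t =
  (-1) ^+ inversions s t * colour_boundary (~: A) c (t :|: s).
Proof.
move=> cPhi kA tL; rewrite boundaryE // /colour_boundary.
move: tL; rewrite inE => /andP[dts tsPhi]; rewrite tsPhi mulr_sumr.
rewrite (bigID (fun v => (v \notin s) && (v |: (t :|: s) \in Phi))) /=.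
rewrite [X in _ + X]big1 ?addr0; last first.
  move=> v /andP[vt nP]; rewrite ffunE -setUA disjointsU1 dts andbT.
  by case: ifPn nP => [vs /= /cPhi ->|_]; rewrite ?mulr0.
rewrite [RHS](bigID (fun v => v |: (t :|: s) \in Phi)) /=.
rewrite [X in _ = _ + X]big1 ?addr0; last first.
  by move=> v /andP[_ /cPhi ->]; rewrite !mulr0.
apply: eq_big => v.
  rewrite !inE negb_or -!andbA; case vt: (v \notin t) => //=.
  case vs: (v \notin s) => //=; case: (boolP (_ \in Phi)) => [vPhi|]; rewrite ?andbF //.
  have vts : v \notin t :|: s by rewrite inE negb_or vt vs.
  have := kappa_U1 vts vPhi; rewrite imsetU kA inE negb_or => /andP[_ ->] //.
move=> /andP[vt /andP[vs vPhi]]; rewrite ffunE disjointsU1 vs dts /=.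
by rewrite !mulrA -setUA -inversionsU1 // [X in _ = X * _]mulrC.
Qed.

(** Twisting a cycle by each [s] of colour set [A] gives cycles in the links; their fillings are
    glued to a filling of the whole cycle. *)
Lemma serre_exact_at l A n : serre_condition R l Phi ->
  (n < #|A| + minn #|~: A| l)%N -> exact_at R A (~: A) n.
Proof.
move=> hS ltn z zS bz0; have [_ cvx pure kinj] := balPhi.
have [ltnA|leAn] := ltnP n #|A|.
  exists (fun=> 0) => [//|t]; rewrite /colour_boundary zS; last first.
    rewrite !inE; apply/negP=> /and4P[_ /subset_leq_card At _ /eqP tn].
    by move: (leq_trans At (leq_imset_card kappa (mem t))); rewrite tn leqNgt ltnA.
  by case: ifP => // _; apply: big1 => v _; rewrite mulr0.
have zPhi r : r \notin Phi -> z r = 0 by apply: supported_Phi zS.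
(* The link faces that come from [z] have [i] vertices, thus degree [i - 1], as in the Serre
   condition. *)
pose i := (n - #|A|)%N.
(* Such an [s] lies in a face but need not itself belong to [Phi]. *)
pose C s := (kappa @: s == A) && [exists t in Phi, s \subset t].
have cardC s : C s -> #|s| = #|A|.
  case/andP=> /eqP <- /exists_inP[t tPhi st]; rewrite card_in_imset //.
  by move=> x y /(subsetP st) xt /(subsetP st) yt; apply: (kinj t).
have lti : (i < minn (d - #|A|) l)%N.
  by move: ltn; rewrite [#|~: A|]cardsCs setCK card_ord ltn_subLR.
have link_card s t : C s -> t \in link Phi s ->
    (t :|: s \in faces A (~: A) (#|t| + #|A|)).
  move=> Cs; rewrite inE => /andP[dts tsPhi]; rewrite inE tsPhi /= setUCr subsetT.
  have /andP[/eqP kA _] := Cs; rewrite imsetU kA subsetUr /= -(cardC s Cs).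
  by rewrite cardsU (disjoint_setI0 dts) cards0 subn0.
(* The implication is inside the existential so that finite choice yields one function of [s], with
   default 0. *)
have filling s : exists b : {ffun {set V} -> R}, C s ->
    is_chain (link Phi s) i%:Z b /\ boundary (link Phi s) b = twist s z.
  case Cs: (C s); last by exists 0.
  have sA := cardC s Cs; case/andP: (Cs) => /eqP kA /exists_inP[t0 t0Phi st0].
  have ex_t0 : exists2 t, t \in Phi & s \subset t by exists t0.
  (* By purity [s] lies in a face with [d] vertices, so its link contains a face with [d - #|A|]
     vertices. *)
  have le_i : i%:Z <= Num.min (dimc (link Phi s)) (l%:Z - 1).
    have [t1 t1Phi [t01 t1d]] := pure t0 t0Phi; have st1 := subset_trans st0 t01.
    have dimL : (d - #|A| <= \max_(t in link Phi s) #|t|)%N.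
      have -> : (d - #|A| = #|t1 :\: s|)%N by rewrite cardsD (setIidPr st1) t1d sA.
      apply: (@leq_bigmax_cond _ _ (fun t : {set V} => #|t|)).
      rewrite inE disjoints_subset setDE subsetIr /= -setDE setUC.
      by rewrite -{1}(setIidPr st1) setID.
    move: lti; rewrite leq_min => /andP[lti1 lti2].
    rewrite le_min /dimc !lerBrDr -[1]/(1%:Z) -!PoszD !lez_nat !addn1 lti2 andbT.
    exact: leq_trans lti1 dimL.
  have [||b bch bE] := hS s ex_t0 _ le_i (twist s z); last 1 first.
  - by exists b => _; split=> //; move: bch; rewrite subrK.
  - move=> t; rewrite ffunE; case: ifP => [dts|_]; last by rewrite eqxx.
    rewrite mulf_eq0 signr_eq0 /= subrK => nz.
    have: t :|: s \in faces A (~: A) n by apply: contraNT nz => /zS ->.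
    rewrite !inE dts => /and4P[-> _ _ /eqP tsn]; split=> //.
    by rewrite /i -tsn -sA cardsU (disjoint_setI0 dts) cards0 subn0 addnK.
  - apply/ffunP=> t; rewrite [RHS]ffunE; case tL: (t \in link Phi s).
      by rewrite (boundary_twist zPhi kA tL) bz0 mulr0.
    by rewrite boundary_out ?tL.
have [b bP] := fin_all_exists filling.
(* A face determines [s] as its part coloured by [A], so the fillings for different [s] do not
   interfere in [y]. *)
pose part t := [set v in t | kappa v \in A].
pose y t := if t \in faces A (~: A) n.+1 then
  (-1) ^+ inversions (part t) (t :\: part t) * b (part t) (t :\: part t) else 0.
have partU s t : C s -> [disjoint t & s] -> t :|: s \in Phi -> part (t :|: s) = s.
  case/andP=> /eqP kA _ dts tsPhi; apply/setP=> v; rewrite !inE -kA.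
  case vs: (v \in s); first by rewrite orbT imset_f.
  rewrite orbF; apply/negP=> /andP[vt /imsetP[u us kvu]].
  have vu : v = u by apply: (kinj _ tsPhi) kvu; rewrite inE ?vt ?us ?orbT.
  by rewrite vu us in vs.
have twist_y s : C s -> twist s y = b s.
  move=> Cs; have [bch _] := bP s Cs; apply/ffunP=> t; rewrite ffunE.
  have b0 : ~~ ([disjoint t & s] && (t :|: s \in faces A (~: A) n.+1)) -> b s t = 0.
    move=> nF; apply/eqP; apply: contraNT nF => /bch[tL tn].
    have := tL; rewrite inE => /andP[-> tsPhi] /=; have := link_card s t Cs tL.
    move: tn; rewrite -[1]/(1%:Z) -PoszD => -[->].
    by rewrite /i addn1 addSn subnK.
  case: ifPn => [dts|ndts]; last by rewrite b0 // (negPf ndts).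
  rewrite /y; case: ifPn => [tsF|ntsF]; last by rewrite mulr0 b0 // (negPf ntsF) andbF.
  rewrite (partU s t) ?(faces_Phi tsF) // setDUl setDv setU0 (setDidPl dts).
  by rewrite signrMK.
exists y => t; first by rewrite /y => /negPf->.
have [tF|ntF] := boolP (t \in faces A (~: A) n); last first.
  rewrite zS //; apply: supported_boundary ntF; first by rewrite disjoints_subset setCK.
  by move=> s /negPf sF; rewrite /y sF.
have tPhi := faces_Phi tF; have := tF; rewrite inE => /and4P[_ /subsetP At _ _].
set s := part t; have st : s \subset t by apply/subsetP=> v; rewrite inE => /andP[].
have kA : kappa @: s = A.
  apply/setP=> a; apply/imsetP/idP => [[v]|/[dup] aA /At /imsetP[v vt av]].
    by rewrite inE => /andP[_ vA] ->.
  by exists v; rewrite // inE vt -av.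
have Cs : C s by rewrite /C kA eqxx; apply/exists_inP; exists t.
have tE : (t :\: s) :|: s = t by rewrite setUC -{1}(setIidPr st) setID.
have dts : [disjoint t :\: s & s] by rewrite disjoints_subset setDE subsetIr.
have tL : t :\: s \in link Phi s by rewrite inE dts tE.
apply: (inv_inj (signrMK (inversions s (t :\: s)))).
rewrite -[X in colour_boundary _ _ X]tE -(boundary_twist _ kA tL); last first.
  by move=> r rPhi; rewrite /y ifN //; apply: contra rPhi => /faces_Phi.
by rewrite twist_y // (bP s Cs).2 ffunE dts tE.
Qed.

End SerreCondition.
End ColourComplexes.

(** * Boundary matrices, the group action and alternating sums of face characters *)

Section FaceCharacters.
Variables (V : finType) (d : nat) (Phi : {set {set V}}) (kappa : V -> 'I_d).
Hypothesis balPhi : balanced_relative_complex Phi kappa.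
Implicit Types (A B C : {set 'I_d}) (s t : {set V}) (n : nat).

(** The sum has at most one term. Integer values allow one matrix to serve all coefficient rings. *)
Definition incidence B s t : int :=
  \sum_(v | [&& v \notin t, kappa v \in B & s == v |: t])
     (-1) ^+ colour_pos kappa v t.

Definition boundary_mx A B n : 'M[int]_(_, _) :=
  \matrix_(i < #|faces Phi kappa A B n.+1|, j < #|faces Phi kappa A B n|)
     incidence B (enum_val i) (enum_val j).

Section Rows.
Variable K : comNzRingType.

Definition row_of_chain A B n (c : {set V} -> K) :
    'rV[K]_#|faces Phi kappa A B n| := \row_i c (enum_val i).

Definition chain_of_row A B n (u : 'rV[K]_#|faces Phi kappa A B n|) s : K :=
  \sum_i u 0 i *+ (enum_val i == s).

Lemma chain_of_rowK A B n : cancel (@chain_of_row A B n) (@row_of_chain A B n).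
Proof.
move=> u; apply/rowP=> i; rewrite mxE /chain_of_row (bigD1 i) //= eqxx big1 ?addr0 //.
by move=> j nji; rewrite (inj_eq enum_val_inj) (negPf nji).
Qed.

Lemma chain_of_row_supported A B n u :
  supported Phi kappa A B n (@chain_of_row A B n u).
Proof.
move=> s sF; apply: big1 => i _; case: eqP => // si.
by move: sF; rewrite -si enum_valP.
Qed.

Lemma eq_row_of_chain A B n (c z : {set V} -> K) : (forall s, c s = z s) ->
  row_of_chain A B n c = row_of_chain A B n z.
Proof. by move=> cz; apply/rowP=> i; rewrite !mxE. Qed.

Lemma mul_boundary_mx A B n (c : {set V} -> K) :
  supported Phi kappa A B n.+1 c ->
  row_of_chain A B n.+1 c *m map_mx intr (boundary_mx A B n) =
  row_of_chain A B n (colour_boundary Phi kappa B c).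
Proof.
move=> cS; apply/rowP=> j; rewrite !mxE /colour_boundary.
rewrite (faces_Phi (enum_valP j)); set t := enum_val j.
rewrite (eq_bigr (fun i => c (enum_val i) * (incidence B (enum_val i) t)%:~R)).
  rewrite -(big_enum_val (fun s => c s * (incidence B s t)%:~R)) /=.
  transitivity (\sum_s c s * (incidence B s t)%:~R).
    rewrite big_mkcond /=; apply: eq_bigr => s _.
    by case: ifPn => // /cS->; rewrite mul0r.
  rewrite (eq_bigr (fun s => \sum_(v | [&& v \notin t, kappa v \in B & s == v |: t])
     (-1) ^+ colour_pos kappa v t * c s)).
    rewrite (exchange_big_dep (fun v => (v \notin t) && (kappa v \in B))) /=.
      apply: eq_bigr => v /andP[vt vB]; rewrite (big_pred1 (v |: t)) // => s.
      by rewrite vt vB.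
    by move=> s v _ /and3P[-> ->].
  move=> s _; rewrite rmorph_sum mulr_sumr; apply: eq_bigr => v _.
  by rewrite rmorphXn rmorphN1 mulrC.
by move=> i _; rewrite !mxE.
Qed.

Lemma row_of_chain0 A B n : row_of_chain A B n (fun=> 0) = 0.
Proof. by apply/rowP=> i; rewrite !mxE. Qed.

Lemma exact_at_mx A B n (u : 'rV[K]_#|faces Phi kappa A B n|) :
    exact_at Phi kappa K A B n ->
    (forall t, colour_boundary Phi kappa B (chain_of_row u) t = 0) ->
  exists w : 'rV[K]_#|faces Phi kappa A B n.+1|,
    w *m map_mx intr (boundary_mx A B n) = u.
Proof.
move=> ex u0; have [y yS yE] := ex _ (@chain_of_row_supported A B n u) u0.
exists (row_of_chain A B n.+1 y); rewrite mul_boundary_mx //.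
by rewrite (eq_row_of_chain _ _ _ yE) chain_of_rowK.
Qed.

Lemma colour_boundary_row0 A B n (u : 'rV[K]_#|faces Phi kappa A B n.+1|) :
    [disjoint A & B] -> u *m map_mx intr (boundary_mx A B n) = 0 ->
  forall t, colour_boundary Phi kappa B (chain_of_row u) t = 0.
Proof.
move=> dAB; rewrite -{1}(chain_of_rowK u) mul_boundary_mx; last first.
  exact: chain_of_row_supported.
move=> row0 t; have [tF|tF] := boolP (t \in faces Phi kappa A B n).
  move/rowP/(_ (enum_rank_in tF t)): row0; rewrite !mxE.
  by rewrite enum_rankK_in.
exact: supported_boundary dAB (@chain_of_row_supported A B n.+1 u) _ tF.
Qed.

End Rows.

Lemma boundary_mxK A B n : [disjoint A & B] ->
  boundary_mx A B n.+1 *m boundary_mx A B n = 0.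
Proof.
move=> dAB; apply/row_matrixP=> i; rewrite row0 row_mul.
(* Over the integers [intr] is the identity, so [mul_boundary_mx] applies to the matrices
   themselves. *)
have intE p m (M : 'M[int]_(p, m)) : M = map_mx intr M.
  by apply/matrixP=> a b; rewrite mxE intz.
set u := row i _; rewrite (intE _ _ (boundary_mx A B n)).
rewrite /u rowE (intE _ _ (boundary_mx A B n.+1)) -(chain_of_rowK (delta_mx 0 i)).
have cS := @chain_of_row_supported int A B n.+2 (delta_mx 0 i).
rewrite mul_boundary_mx // mul_boundary_mx; last exact: supported_boundary.
rewrite -(row_of_chain0 int A B n); apply: eq_row_of_chain => t.
by apply: colour_boundaryK => // s; apply: supported_Phi cS.
Qed.

Lemma exact_boundary_mx (R : idomainType) A B n : [disjoint A & B] ->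
    exact_at Phi kappa R A B n.+1 ->
  (kermx (map_mx intr (boundary_mx A B n)) :=:
     (map_mx intr (boundary_mx A B n.+1) : 'M[algC]_(_, _)))%MS.
Proof.
move=> dAB ex; apply: (@exact_intr_char0 R); first exact: boundary_mxK.
by move=> u u0; apply: exact_at_mx => //; apply: colour_boundary_row0.
Qed.

(** The bottom degree is the case of [exact_intr_char0] in which the outgoing map is zero, with
    target of dimension 0. *)
Lemma full_boundary_mx0 (R : idomainType) A B : exact_at Phi kappa R A B 0 ->
  row_full (map_mx intr (boundary_mx A B 0) : 'M[algC]_(_, _)).
Proof.
move=> ex; pose N : 'M[int]_(#|faces Phi kappa A B 0|, 0) := 0.
have e : (kermx (map_mx intr N : 'M[algC]_(_, 0)) :=:
           (map_mx intr (boundary_mx A B 0) : 'M[algC]_(_, _)))%MS.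
  apply: (@exact_intr_char0 R) => [|u _]; first by rewrite mulmx0.
  apply: exact_at_mx => // t; rewrite /colour_boundary.
  case: ifP => // _; apply: big1 => v /andP[vt _].
  rewrite (@chain_of_row_supported R A B 0 u) ?mulr0 //.
  by rewrite !inE cardsU1 vt !andbF.
have kN : (1%:M <= kermx (map_mx intr N : 'M[algC]_(_, 0)))%MS.
  by apply/sub_kermxP/matrixP=> i [].
by rewrite -sub1mx; apply: submx_trans kN _; rewrite e.
Qed.

Variables (gT : finGroupType) (G : {group gT}) (to : action G V).
Local Notation act_sets := (to^*)%act.
Hypothesis actG : acts_on_complex Phi kappa to.

Lemma imset_kappa_act g s : g \in G -> kappa @: (act_sets s g) = kappa @: s.
Proof.
move=> Gg; rewrite /= /setact -imset_comp.
by apply: eq_imset => v /=; case: actG => ->.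
Qed.

Lemma acts_faces A B n : [acts G, on faces Phi kappa A B n | act_sets].
Proof.
case: actG => kG nPhi; apply/subsetP=> g Gg; rewrite !inE Gg /=.
apply/subsetP=> s; rewrite !inE => /and4P[Ps As sAB /eqP <-].
rewrite (acts_act nPhi) // Ps imset_kappa_act // As sAB.
by rewrite /= card_setact.
Qed.

(** The action preserves colours, hence positions in the colour order; an order on the vertices need
    not be preserved. *)
Lemma incidence_act B s t g : g \in G ->
  incidence B (act_sets s g) (act_sets t g) = incidence B s t.
Proof.
move=> Gg; have [kG _] := actG; have ginj := act_inj to g.
have mem_act v r : (to v g \in act_sets r g) = (v \in r).
  by rewrite /= /setact (mem_imset _ _ ginj).
rewrite /incidence (reindex_inj ginj) /=; apply: eq_big => v.
  rewrite mem_act kG //; congr [&& _, _ & _].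
  have -> : to v g |: setact to t g = setact to (v |: t) g.
    by rewrite /setact imsetU1.
  by rewrite (inj_eq (act_inj act_sets g)).
move=> _; congr (_ ^+ _); rewrite /colour_pos /setact big_imset /=; last first.
  by move=> x y _ _ /ginj.
by apply: eq_bigr => w _; rewrite !kG.
Qed.

Lemma act_perm_mx_boundary A B n g : g \in G ->
  act_perm_mx act_sets (faces Phi kappa A B n.+1) g *m map_mx intr (boundary_mx A B n) =
  map_mx intr (boundary_mx A B n) *m act_perm_mx act_sets (faces Phi kappa A B n) g.
Proof.
move=> Gg; have nF m := acts_faces A B m; apply/matrixP=> i j; rewrite !mxE.
have Fi : act_sets (enum_val i) g \in faces Phi kappa A B n.+1.
  by rewrite (acts_act (nF _)) ?enum_valP.
have Fj : act_sets (enum_val j) g^-1%g \in faces Phi kappa A B n.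
  by rewrite (acts_act (nF _)) ?groupV ?enum_valP.
(* Each product has one nonzero term: the translate of row [i] by [g] on the left, that of column
   [j] by the inverse on the right. *)
rewrite (bigD1 (enum_rank_in Fi (act_sets (enum_val i) g))) //= big1 ?addr0; last first.
  move=> k nk; rewrite !mxE; case: eqP => [e|_]; last by rewrite mul0r.
  by case/eqP: nk; apply: enum_val_inj; rewrite enum_rankK_in.
rewrite (bigD1 (enum_rank_in Fj (act_sets (enum_val j) g^-1%g))) //= big1 ?addr0; last first.
  move=> k nk; rewrite !mxE; case: eqP => [e|_]; last by rewrite mulr0.
  case/eqP: nk; apply: enum_val_inj; rewrite enum_rankK_in // -e.
  by rewrite -[RHS]/(act_sets (act_sets _ _) _) actKin.
rewrite !mxE !enum_rankK_in //.
have KV : act_sets (act_sets (enum_val j) g^-1%g) g = enum_val j by rewrite actKVin.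
by rewrite -{1}KV /= eqxx mul1r incidence_act // KV eqxx mulr1.
Qed.

Lemma alternating_faces_char (R : idomainType) A B (b := (#|A| + #|B|)%N) :
    [disjoint A & B] -> (forall n, (n < b)%N -> exact_at Phi kappa R A B n) ->
  \sum_(m < b.+1) (-1) ^+ (b - m) *: perm_char (acts_faces A B m) \is a character.
Proof.
move=> dAB ex; apply: (@alternating_exact_char _ _ b _
  (fun m => MxRepresentation (act_perm_mx_repr (acts_faces A B m)))
  (fun m => map_mx intr (boundary_mx A B m))) => [k x Gx|b0|k ltkb].
- exact: act_perm_mx_boundary.
- exact: full_boundary_mx0 (ex 0%N b0).
- exact: exact_boundary_mx (ex _ ltkb).
Qed.

(** At [g] both sides are one signed sum over the fixed faces, grouped by cardinality or by the
    colours outside [A]; a face has as many vertices as colours. *)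
Lemma alternating_faces_f A B (b := (#|A| + #|B|)%N) : [disjoint A & B] ->
  \sum_(m < b.+1) (-1) ^+ (b - m) *: perm_char (acts_faces A B m) =
  \sum_(C : {set 'I_d} | C \subset B) (-1) ^+ #|B :\: C| *: f_color actG (A :|: C).
Proof.
move=> dAB; apply/cfun_inP=> g Gg; rewrite !sum_cfunE.
pose P s := [&& s \in Phi, A \subset kappa @: s, kappa @: s \subset A :|: B
              & s \in 'Fix_act_sets[g]].
have card_P s : P s -> #|s| = #|kappa @: s|.
  case/and4P=> sPhi _ _ _; case: balPhi => _ _ _ kinj.
  by rewrite card_in_imset //; apply: kinj.
have cardAB : #|A :|: B| = b by rewrite cardsU (disjoint_setI0 dAB) cards0 subn0.
transitivity (\sum_(s | P s) (-1) ^+ (b - #|s|) : algC).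
  rewrite (partition_big (fun s => inord #|s| : 'I_b.+1) xpredT) //=.
  have inordE s : P s -> nat_of_ord (inord #|s| : 'I_b.+1) = #|s|.
    move=> Ps; rewrite inordK // ltnS card_P // -cardAB subset_leq_card //.
    by case/and4P: Ps.
  apply: eq_bigr => m _; rewrite cfunE perm_charE // -sum1_card natr_sum mulr_sumr.
  apply: eq_big => [s|s].
    rewrite !inE; apply/andP/andP=> [[/and4P[sPhi As sAB /eqP sm] sg]|[Ps /eqP sm]].
      have Ps : P s by apply/and4P; split; rewrite // !inE.
      by split=> //; rewrite -val_eqE /= inordE // sm.
    have /and4P[-> -> -> sg] := Ps; rewrite -sm inordE // eqxx.
    by split=> //; move: sg; rewrite !inE.
  by rewrite inE mulr1 => /andP[]; rewrite inE => /and4P[_ _ _ /eqP ->].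
rewrite (partition_big (fun s => kappa @: s :\: A) (fun C => C \subset B)) /=; last first.
  by move=> s /and4P[_ _ sAB _]; rewrite subDset.
apply: eq_bigr => C CB; rewrite cfunE perm_charE // -sum1_card natr_sum mulr_sumr.
have dAC : [disjoint C & A] by rewrite disjoint_sym (disjointWr CB).
apply: eq_big => [s|s /andP[Ps /eqP sC]].
  rewrite !inE; apply/andP/andP=> [[Ps /eqP sC]|[/andP[sPhi /eqP sAC] sg]].
    case/and4P: Ps => -> As _ sg; split; last by move: sg; rewrite !inE.
    by rewrite -sC -{1}(setID (kappa @: s) A) (setIidPr As) eqxx.
  split; last by rewrite sAC setDUl setDv set0U (setDidPl dAC).
  by apply/and4P; split; rewrite // ?sAC ?subsetUl ?setUS // !inE.
have As : A \subset kappa @: s by case/and4P: Ps.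
rewrite mulr1 card_P // cardsD (setIidPr CB) -sC cardsD (setIidPr As).
by rewrite subnBA ?subset_leq_card // addnC.
Qed.

End FaceCharacters.

(** * Signed sums and counts over intervals of subsets *)

Section SubsetSums.
Variable T : finType.
Implicit Types S X Y U : {set T}.

(** Inserting or deleting [x] pairs the sets [U] with opposite signs. *)
Lemma alternating_interval_sum (R : pzRingType) S X Y x :
    S \subset X -> x \in Y -> x \notin X ->
  \sum_(U : {set T} | (X \subset U) && (U \subset Y)) (-1) ^+ #|U :\: S| = 0 :> R.
Proof.
move=> SX xY xX; have xS : x \notin S by apply: contra xX => /(subsetP SX).
rewrite (bigID (fun U : {set T} => x \in U)) /=.
rewrite (reindex_onto (fun U => x |: U) (fun U => U :\ x)) /=; last first.
  by move=> U /andP[_ xU]; rewrite setD1K.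
rewrite (eq_bigl (fun U => ((X \subset U) && (U \subset Y)) && (x \notin U))).
  rewrite -big_split big1 //= => U /andP[_ xU].
  have -> : (x |: U) :\: S = x |: (U :\: S).
    by rewrite setDUl; congr (_ :|: _); apply/setDidPl; rewrite disjoints1.
  by rewrite cardsU1 inE (negPf xU) andbF exprS mulN1r addNr.
move=> U; rewrite setU11 andbT; case xU: (x \in U).
  rewrite andbF; apply/negP=> /andP[_ /eqP/setP/(_ x)].
  by rewrite xU !inE eqxx.
rewrite setU1K ?xU // eqxx subUset sub1set xY !andbT.
by congr (_ && _); rewrite -[in RHS](setU1K (negbT xU)) subsetD1 xX andbT.
Qed.

Lemma card_supersets S U k : S \subset U -> (#|S| <= k)%N ->
  #|[set X : {set T} | [&& S \subset X, X \subset U & #|X| == k]]| =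
  'C(#|U| - #|S|, k - #|S|).
Proof.
move=> SU leSk; have -> : (#|U| - #|S|)%N = #|U :\: S|.
  by rewrite cardsD (setIidPr SU).
rewrite -cards_draws.
have injS : {in [set Y : {set T} | (Y \subset U :\: S) & #|Y| == (k - #|S|)%N] &,
             injective (fun Y => S :|: Y)}.
  move=> X Y; rewrite !inE => /andP[XU _] /andP[YU _] e.
  have dj (Z : {set T}) : Z \subset U :\: S -> (S :|: Z) :\: S = Z.
    by rewrite subsetD => /andP[_ dZS]; rewrite setDUl setDv set0U (setDidPl dZS).
  by rewrite -(dj X XU) e dj.
rewrite -(card_in_imset injS); apply: eq_card => X; rewrite inE.
apply/and3P/imsetP => [[SX XU /eqP <-]|[Y]].
  exists (X :\: S); last by rewrite -{1}(setIidPr SX) setID.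
  by rewrite inE setSD //= cardsD (setIidPr SX) eqxx.
rewrite inE subsetD => /andP[/andP[YU dYS] /eqP cY] ->.
rewrite subsetUl subUset SU YU cardsU setIC (disjoint_setI0 dYS) cards0 subn0.
by rewrite cY subnKC ?eqxx.
Qed.

End SubsetSums.

(** * Subsets containing an initial segment of the colours *)

Section InitialSegments.
Variable d : nat.
Implicit Types (S T B F : {set 'I_d}) (r : nat).

Lemma initial_segment S r : (r <= #|S|)%N ->
  exists F, [/\ F \subset S, #|F| = r
    & forall x y, x \in S -> x \notin F -> y \in F -> (y < x)%N].
Proof.
elim: r => [_|r IHr ltrS].
  by exists set0; split=> [||x y _ _]; rewrite ?sub0set ?cards0 ?inE.
have [F [FS cF ltF]] := IHr (ltnW ltrS).
have [x0 x0SF] : exists x, x \in S :\: F.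
  by apply/set0Pn; rewrite -card_gt0 cardsD (setIidPr FS) cF subn_gt0.
case: (@arg_minnP _ x0 [in S :\: F] (@nat_of_ord d) x0SF) => m mSF minm.
have /setDP[mS mF] : m \in S :\: F := mSF.
exists (m |: F); split=> [||x y xS]; first by rewrite subUset sub1set mS.
  by rewrite cardsU1 mF cF.
rewrite !in_setU1 negb_or => /andP[xm xF] /predU1P[->|]; last exact: ltF.
rewrite ltn_neqAle (inj_eq val_inj) eq_sym xm /=; apply: minm.
by apply/setDP.
Qed.

(** The colours whose addition to [B] leaves its [r] smallest elements unchanged. *)
Definition late_colours r B T : {set 'I_d} :=
  [set x in T :\: B | (r <= #|[set y in B | (y < x)%N]|)%N].

Lemma late_colours_disjoint r B T : [disjoint late_colours r B T & B].
Proof.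
by rewrite disjoints_subset; apply/subsetP=> x; rewrite !inE => /andP[/andP[]].
Qed.

(* If F is formed of the first r elements of S, the condition on B means that F is
   contained in B. *)
Lemma card_late_colours S T l r : S \subset T -> (r <= l <= #|S|)%N ->
  #|[set B : {set 'I_d} |
      [&& B \subset S, S \subset late_colours r B T :|: B & #|B| == l]]| =
  'C(#|S| - r, l - r).
Proof.
move=> ST /andP[rl lS]; have [F [FS cF ltF]] := initial_segment (leq_trans rl lS).
rewrite -cF -card_supersets ?cF //; apply: eq_card => B; rewrite !inE andbCA.
case BS: (B \subset S); last by rewrite !andbF.
rewrite /=; case cB: (#|B| == l); rewrite ?andbF ?andbT //.
apply/subsetP/subsetP=> [H x xF|H x xS].
  (* If [x] in [F] were outside [B], at least [r] elements of [B] would precede it; all of them lie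
     in [F], which has only [r - 1] other elements. *)
  have := H x (subsetP FS x xF); rewrite !inE; case: (x \in B) => //=.
  rewrite orbF => /andP[_]; rewrite leqNgt => /negP[].
  rewrite -cF [X in (_ < X)%N](cardsD1 x) xF add1n ltnS; apply: subset_leq_card.
  apply/subsetP=> y; rewrite !inE => /andP[yB yx].
  rewrite neq_ltn yx /=; apply/negPn/negP=> yF.
  by have := ltF y x (subsetP BS y yB) yF xF; rewrite ltnNge ltnW.
rewrite !inE (subsetP ST) // andbT; case xB: (x \in B); rewrite ?orbT ?orbF //=.
(* Conversely [x] is outside [F], so it is preceded by all [r] elements of [F], and these lie in
   [B]. *)
rewrite -cF; apply: subset_leq_card; apply/subsetP=> y yF.
by rewrite inE H //= ltF //; apply: contraFN xB; apply: H.
Qed.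

End InitialSegments.

(** * Interval sums of the colour-refined h-vector *)

Section HVectors.
Variables (V : finType) (d : nat) (Phi : {set {set V}}) (kappa : V -> 'I_d).
Variables (gT : finGroupType) (G : {group gT}) (to : action G V).
Hypothesis actG : acts_on_complex Phi kappa to.
Implicit Types (A B C S T : {set 'I_d}).

(** The coefficient of [f_color actG T] is a signed sum over the [S] between [B :|: T] and
    [A :|: B]. It cancels if [T] misses a colour of [A]; otherwise only [A :|: B] remains. *)
Lemma h_color_interval A B : [disjoint A & B] ->
  \sum_(S : {set 'I_d} | (B \subset S) && (S \subset A :|: B)) h_color actG S =
  \sum_(C : {set 'I_d} | C \subset B) (-1) ^+ #|B :\: C| *: f_color actG (A :|: C).
Proof.
move=> dAB; rewrite (exchange_big_dep xpredT) //=.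
rewrite (eq_bigr (fun T => if (A \subset T) && (T \subset A :|: B)
   then (-1) ^+ #|(A :|: B) :\: T| *: f_color actG T else 0)) => [|T _].
  rewrite -big_mkcond /= (reindex_onto (fun C => A :|: C) (fun T => T :\: A)) /=.
    apply: eq_big => C; last first.
      move=> _; congr ((-1) ^+ _ *: _).
      have dBA : [disjoint B & A] by rewrite disjoint_sym.
      by rewrite -setDDl setDUl setDv set0U (setDidPl dBA).
    rewrite subsetUl /= -subDset setDUl setDv set0U.
    apply/andP/idP=> [[CAB /eqP e]|CB]; first by rewrite -e.
    have dCA : [disjoint C & A] by rewrite disjoint_sym (disjointWr CB).
    by rewrite (setDidPl dCA) CB eqxx.
  by move=> T /andP[AT _]; rewrite -{1}(setIidPr AT) setID.
rewrite -scaler_suml; case: ifPn => [/andP[AT TAB]|nT].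
  rewrite (big_pred1 (A :|: B)) // => S /=.
  apply/idP/eqP => [/andP[/andP[BS SAB] TS]|->]; last by rewrite subsetUr subxx TAB.
  by apply/eqP; rewrite eqEsubset SAB subUset (subset_trans AT TS).
have [TAB|nTAB] := boolP (T \subset A :|: B); last first.
  rewrite big_pred0 ?scale0r // => S; apply: contraNF nTAB.
  by move=> /andP[/andP[_ SAB] TS]; apply: subset_trans TS SAB.
move: nT; rewrite TAB andbT => /subsetPn[a aA aT].
rewrite (eq_bigl (fun S => (B :|: T \subset S) && (S \subset A :|: B))); last first.
  by move=> S; rewrite subUset andbAC.
rewrite (alternating_interval_sum _ (x := a)) ?scale0r ?subsetUr ?inE ?aA //.
by rewrite negb_or (disjointFr dAB aA).
Qed.

Variables (R : idomainType) (l : nat).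
Hypothesis balPhi : balanced_relative_complex Phi kappa.
Hypothesis serrePhi : serre_condition R l Phi.

(** The bound on [B] gives exactness in every degree below the top one, [#|A| + #|B|]. *)
Lemma h_color_interval_char A B : [disjoint A & B] -> (#|B| <= l)%N ->
  \sum_(S : {set 'I_d} | (B \subset S) && (S \subset A :|: B)) h_color actG S
    \is a character.
Proof.
move=> dAB leBl; rewrite h_color_interval // -(alternating_faces_f balPhi) //.
apply: (alternating_faces_char balPhi actG (R := R) dAB) => n ltn.
apply: (exact_at_disjoint balPhi (K := R) (l := l)) => //; last by rewrite (minn_idPl leBl).
by move=> A' n'; apply: serre_exact_at.
Qed.

Lemma h_vector_sumE (c : nat -> nat) j :
  \sum_(l <= k < j.+1) h_vector actG k *+ c k =
  \sum_(S : {set 'I_d} | (l <= #|S| <= j)%N) h_color actG S *+ c #|S|.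
Proof.
rewrite (eq_bigr (fun k => \sum_(S : {set 'I_d} | #|S| == k) h_color actG S *+ c k)).
  rewrite (exchange_big_dep xpredT) //= [RHS]big_mkcond /=.
  apply: eq_bigr => S _; rewrite (eq_bigl (fun k => k == #|S|)); last first.
    by move=> k; rewrite eq_sym.
  by rewrite big_nat1_eq ltnS.
by move=> k _; rewrite -sumrMnl.
Qed.

(** Double counting: for fixed [S], [card_supersets] counts the sets [T] and, for each of them,
    [card_late_colours] counts the sets [B]. *)
Lemma late_colours_sum i j : (i <= l <= j)%N ->
  \sum_(S : {set 'I_d} | (l <= #|S| <= j)%N)
     h_color actG S *+ ('C(d - #|S|, j - #|S|) * 'C(#|S| - l + i, i)) =
  \sum_(T : {set 'I_d} | #|T| == j)
    \sum_(B : {set 'I_d} | (B \subset T) && (#|B| == l))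
      \sum_(S : {set 'I_d} |
         (B \subset S) && (S \subset late_colours (l - i) B T :|: B)) h_color actG S.
Proof.
move=> /andP[il lj]; rewrite [LHS]big_mkcond /=.
under [RHS]eq_bigr do rewrite (exchange_big_dep xpredT) //=.
rewrite [RHS](exchange_big_dep xpredT) //=; apply: eq_bigr => S _.
have late_sub B T : B \subset T -> late_colours (l - i) B T :|: B \subset T.
  by move=> BT; rewrite subUset BT andbT; apply/subsetP=> x; rewrite !inE => /andP[/andP[]].
have countB T : \sum_(B : {set 'I_d} | [&& B \subset T, #|B| == l, B \subset S
      & S \subset late_colours (l - i) B T :|: B]) h_color actG S =
    if (S \subset T) && (l <= #|S|)%N then h_color actG S *+ 'C(#|S| - l + i, i) else 0.
  have [/andP[ST lS]|nST] := ifPn.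
    (* The binomial is put in the form of [card_late_colours] with [r = l - i]. *)
    have -> : 'C(#|S| - l + i, i) = 'C(#|S| - (l - i), l - (l - i)).
      by rewrite subnA ?leq_subr // subKn // addnBAC.
    rewrite -(card_late_colours ST) ?leq_subr // -sumr_const; apply: eq_bigl => B.
    rewrite !inE; case BS: (B \subset S); rewrite ?andbF //= (subset_trans BS ST) /=.
    by rewrite andbC.
  rewrite big_pred0 // => B; apply: contraNF nST => /and4P[BT /eqP cB BS Slate].
  rewrite -[X in (X <= _)%N]cB.
  by rewrite (subset_trans Slate (late_sub B T BT)) (subset_leq_card BS).
transitivity (\sum_(T : {set 'I_d} | #|T| == j) if (S \subset T) && (l <= #|S|)%N
    then h_color actG S *+ 'C(#|S| - l + i, i) else 0).
  case: (leqP l #|S|) => lS /=; last by rewrite big1 // => T _; rewrite andbF.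
  case: leqP => Sj.
    have := card_supersets (subsetT S) Sj; rewrite cardsT card_ord => <-.
    rewrite mulnC mulrnA -sumr_const /=.
    rewrite -big_mkcondr /=; apply: eq_bigl => T; rewrite !inE subsetT andbT.
    by rewrite andbC.
  rewrite big1 // => T /eqP Tj; case: ifP => // /andP[/subset_leq_card].
  by rewrite Tj leqNgt Sj.
apply: eq_big => [T|T _]; first by rewrite andbT.
by rewrite -countB; apply: eq_bigl => B; rewrite -!andbA.
Qed.

End HVectors.

(** * Effectivity of the h-vector and of its binomial sums *)

Theorem theorem1p4 (R : idomainType) (V : finType) (d l : nat)
    (Phi : {set {set V}}) (kappa : V -> 'I_d)
    (gT : finGroupType) (G : {group gT}) (to : action G V)
    (hPhi : balanced_relative_complex Phi kappa)
    (actG : acts_on_complex Phi kappa to)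
    (hS : serre_condition R l Phi) :
  (forall i : nat, (i <= l)%N -> h_vector actG i \is a character) /\
  (forall i j : nat, (i <= l)%N -> (l <= j)%N -> (j <= d)%N ->
     \sum_(l <= k < j.+1)
        h_vector actG k *+ ('C(d - k, j - k) * 'C(k - l + i, i))
       \is a character).
Proof.
split=> [i leil|i j il lj jd].
  rewrite /h_vector; apply: rpred_sum => S /eqP cS.
  (* For empty [A] the interval is [S] alone, so each [h_color actG S] is already a character. *)
  have := h_color_interval_char actG hPhi hS (A := set0) (B := S).
  rewrite disjoints_subset sub0set cS => /(_ isT leil); rewrite set0U.
  by rewrite (big_pred1 S) // => T; rewrite -eqEsubset eq_sym.
rewrite h_vector_sumE late_colours_sum ?il //; apply: rpred_sum => T _.
apply: rpred_sum => B /andP[_ /eqP cB].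
apply: (h_color_interval_char actG hPhi hS); last by rewrite cB.
exact: late_colours_disjoint.
Qed.
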